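(* Let $M=M^*(K_{4,4})$ be the cographic matroid (the dual of the graphic matroid) of the complete bipartite graph $K_{4,4}$. Then $\mu(M)=4$, $\gamma(M)=6$, and $\eta(M)=5$. In particular, $\mu(M)<\eta(M)$.
   Context: For a graph $G$, $M^*(G)$ denotes the cographic matroid of $G$, i.e. the dual of the graphic matroid of $G$; its circuits are the bonds (inclusionwise minimal nonempty cuts) of $G$. A join of a matroid $M$ on ground set $E(M)$ is a set $J\subseteq E(M)$ with $|J\cap C|\le |C|/2$ for every circuit $C$ of $M$. $\mu(M)$ is the maximum size of a join. Ear decompositions: for a nonempty sequence of circuits $C_1,\dots,C_t$ of $M$ put $D_0=\varnothing$ and $D_i=C_1\cup\dots\cup C_i$. The sequence is an ear decomposition of $M$ if $D_t=E(M)$ and for every $i\ge 2$: (E1) $C_i\cap D_{i-1}\neq\varnothing$; (E2) $C_i\setminus D_{i-1}\ne\varnothing$; (E3) no circuit $C$ of $M$ with $C\cap D_{i-1}\neq\varnothing$ and $C\setminus D_{i-1}\neq\varnothing$ has $C\setminus D_{i-1}$ properly contained in $C_i\setminus D_{i-1}$. The set $P_i=C_i\setminus D_{i-1}$ is the $i$th lobe; it is odd or even according to the parity of $|P_i|$. $\varphi(M)$ is the minimum number of even lobes and $\gamma(M)$ the maximum number of odd lobes over all ear decompositions of $M$. For a connected matroid $M$ not isomorphic to $U_{1,1}$ (the one-element rank-$1$ uniform matroid), an ear decomposition exists, every ear decomposition has $|E(M)|-r(M)$ lobes, and $\eta(M):=\frac{r(M)+\varphi(M)}{2}=\frac{|E(M)|-\gamma(M)}{2}$,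 where $r(M)$ is the rank. *)

(* Defs.v *)
From HB Require Import structures.
From mathcomp Require Import all_boot all_order all_algebra.

Set Implicit Arguments.
Unset Strict Implicit.
Unset Printing Implicit Defensive.

Record matroid (E : finType) := Matroid {
  indep : pred {set E};
  indep0 : indep set0;
  indepS : forall A B : {set E}, A \subset B -> indep B -> indep A;
  indep_aug : forall A B : {set E}, indep A -> indep B -> #|A| < #|B| ->
    exists2 e, e \in B :\: A & indep (e |: A) }.

Section MatroidTheory.
Variables (E : finType) (M : matroid E).
Implicit Types (A B C D J : {set E}) (s : seq {set E}).

Definition base B := maxset (indep M) B.
Definition circuit C := minset (fun A => ~~ indep M A) C.
Definition rank := \max_(A : {set E} | indep M A) #|A|.

Lemma indep_extend A B : indep M A -> base B ->
  exists2 B', base B' & (A \subset B') && (B' \subset A :|: B).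
Proof.
move=> iA bB; pose P X := [&& indep M X, A \subset X & X \subset A :|: B].
have PA : P A by rewrite /P iA subxx subsetUl.
have [B' mB' sAB'] := maxset_exists PA.
have /and3P[iB' _ sB'] := maxsetp mB'.
exists B'; last by rewrite sAB'.
have [iB maxB] := maxsetP bB.
have leBB' : #|B| <= #|B'|.
  rewrite leqNgt; apply/negP => /(indep_aug iB' iB)[e].
  rewrite inE => /andP[eB' eB] ie.
  have /(maxsetsup mB') : P (e |: B').
    rewrite /P ie (subset_trans sAB' (subsetUr _ _)) /= subUset sB' andbT.
    by rewrite sub1set inE eB orbT.
  by move/(_ (subsetUr _ _))/setP/(_ e); rewrite !inE eqxx (negPf eB').
apply/maxsetP; split=> // X iX sX; apply/esym/eqP; rewrite eqEcard sX /=.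
rewrite leqNgt; apply/negP => /(leq_ltn_trans leBB') /(indep_aug iB iX)[e].
rewrite inE => /andP[eB eX] ie.
by have /setP/(_ e) := maxB _ ie (subsetUr _ _); rewrite !inE eqxx (negPf eB).
Qed.

Lemma base_exists : exists B, base B.
Proof. by have [B bB _] := maxset_exists (indep0 M); exists B. Qed.

Lemma leq_base B B' : base B -> indep M B' -> #|B'| <= #|B|.
Proof.
move=> /maxsetP[iB maxB] iB'; rewrite leqNgt; apply/negP.
move=> /(indep_aug iB iB')[e]; rewrite inE => /andP[eB _] ie.
by have /setP/(_ e) := maxB _ ie (subsetUr _ _); rewrite !inE eqxx (negPf eB).
Qed.

Definition dual_indep A := [exists B, base B && [disjoint A & B]].

Fact dual_indep0 : dual_indep set0.
Proof.
have [B bB] := base_exists.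
by apply/existsP; exists B; rewrite bB -setI_eq0 set0I eqxx.
Qed.

Fact dual_indepS A B : A \subset B -> dual_indep B -> dual_indep A.
Proof.
move=> sAB /existsP[D /andP[bD dBD]]; apply/existsP; exists D.
by rewrite bD (disjointWl sAB dBD).
Qed.

Fact dual_indep_aug A1 A2 : dual_indep A1 -> dual_indep A2 -> #|A1| < #|A2| ->
  exists2 e, e \in A2 :\: A1 & dual_indep (e |: A1).
Proof.
move=> /existsP[B1 /andP[bB1 d1]] /existsP[B2 /andP[bB2 d2]] ltA.
have iB2 : indep M (B2 :\: A1) by apply: indepS (maxsetp bB2); exact: subsetDl.
have [B bB /andP[sB2 sB]] := indep_extend iB2 bB1.
have dB : [disjoint A1 & B].
  rewrite disjoint_sym; apply: disjointWl sB _.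
  rewrite -setI_eq0 setIUl setU_eq0 !setI_eq0 [X in _ && X]disjoint_sym d1 andbT.
  by rewrite disjoints_subset; apply/subsetP => x; rewrite !inE => /andP[].
case: (boolP (A2 :\: A1 \subset B)) => [sA|/subsetPn[e eA eB]]; last first.
  exists e => //; apply/existsP; exists B; rewrite bB -setI_eq0 setIUl.
  rewrite setU_eq0 !setI_eq0 dB andbT -setI_eq0; apply/eqP/setP=> x; rewrite !inE.
  by apply/andP=> -[/eqP->]; apply/negP.
have dD : [disjoint A2 :\: A1 & B2 :\: A1].
  exact: disjointWl (subsetDl _ _) (disjointWr (subsetDl _ _) d2).
have leB : #|A2 :\: A1| + #|B2 :\: A1| <= #|B2|.
  have /eqP <- : #|A2 :\: A1 :|: B2 :\: A1| == #|A2 :\: A1| + #|B2 :\: A1|.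
    by rewrite (leq_card_setU _ _).2.
  apply: leq_trans (leq_base bB2 (maxsetp bB)).
  by apply: subset_leq_card; rewrite subUset sA.
have sI : #|B2 :&: A1| <= #|A1 :\: A2|.
  apply: subset_leq_card; apply/subsetP=> x; rewrite !inE => /andP[xB ->].
  by rewrite andbT; apply: contraTN xB => xA; rewrite (disjointFr d2 xA).
move: ltA leB sI; rewrite -(cardsID A2 A1) -(cardsID A1 A2) -(cardsID A1 B2) setIC.
rewrite ltn_add2l leq_add2r => h1 h2 h3.
by have := leq_trans h1 (leq_trans h2 h3); rewrite ltnn.
Qed.

Definition dual := Matroid dual_indep0 dual_indepS dual_indep_aug.

Definition join J := [forall C, circuit C ==> (2 * #|J :&: C| <= #|C|)].

Definition mu := \max_(J : {set E} | join J) #|J|.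

(* Indices are shifted by one: in [:: C_1; ...; C_t] the set [span_prefix s i]
   is D_i, and [lobe s i] is P_(i+1) = C_(i+1) \ D_i, for i < t. *)
Definition span_prefix s i := \bigcup_(C <- take i s) C.
Definition lobe s i := nth set0 s i :\: span_prefix s i.

Definition ear_decomposition s :=
  [&& s != [::], all circuit s, span_prefix s (size s) == setT
    & [forall i : 'I_(size s), (0 < i) ==>
        [&& nth set0 s i :&: span_prefix s i != set0,
            lobe s i != set0
          & [forall C, [&& circuit C, C :&: span_prefix s i != set0
                         & C :\: span_prefix s i != set0] ==>
                ~~ (C :\: span_prefix s i \proper lobe s i)]]]].

Definition odd_lobes s := \sum_(i < size s) odd #|lobe s i|.
Definition even_lobes s := \sum_(i < size s) ~~ odd #|lobe s i|.

(* The bounds on the number of lobes only make the index sets finite, see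
   [size_ear_decomposition]. When M has no ear decomposition, the values are
   gamma = 0 and phi = #|E|. *)
Definition gamma :=
  \max_(t < #|E|.+1) \max_(s : t.-tuple {set E} | ear_decomposition s)
    odd_lobes s.
Definition phi :=
  \big[minn/#|E|]_(t < #|E|.+1)
    \big[minn/#|E|]_(s : t.-tuple {set E} | ear_decomposition s) even_lobes s.

Definition eta : rat := ((rank + phi)%:R / 2)%R.

Lemma size_ear_decomposition s : ear_decomposition s -> size s <= #|E|.
Proof.
case/and4P=> _ /allP cs _ /forallP es.
suff H i : i <= size s -> i <= #|span_prefix s i|.
  by apply: leq_trans (H _ (leqnn _)) _; apply: max_card.
elim: i => // i IH lti; apply: leq_ltn_trans (IH (ltnW lti)) _.
have -> : span_prefix s i.+1 = span_prefix s i :|: nth set0 s i.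
  rewrite /span_prefix (take_nth set0 lti) -cats1 big_cat big_seq1.
  by [].
apply: proper_card; rewrite properE subsetUl /= subUset subxx /= -setD_eq0.
case: i lti {IH} => [|i] lti; last first.
  by have /and3P[] := implyP (es (Ordinal lti)) isT.
rewrite /span_prefix take0 big_nil setD0; apply/negP => /eqP s0.
by have /minsetp := cs _ (mem_nth set0 lti); rewrite s0 indep0.
Qed.

Lemma odd_lobes_le_gamma s : ear_decomposition s -> odd_lobes s <= gamma.
Proof.
move=> es; have lts : size s < #|E|.+1 by rewrite ltnS size_ear_decomposition.
rewrite /gamma (bigD1 (Ordinal lts)) //= (bigD1 (in_tuple s)) //=.
by rewrite -maxnA leq_maxl.
Qed.

Lemma phi_le_even_lobes s : ear_decomposition s -> phi <= even_lobes s.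
Proof.
move=> es; have lts : size s < #|E|.+1 by rewrite ltnS size_ear_decomposition.
rewrite /phi; have -> : even_lobes s = even_lobes (in_tuple s) by [].
apply: leq_trans (_ : \big[minn/#|E|]_(r : (size s).-tuple {set E} |
   ear_decomposition r) even_lobes r <= _).
- have := mem_index_enum (Ordinal lts).
  elim: (index_enum _) => // i r IH; rewrite inE big_cons => /predU1P[<-|/IH ler].
    exact: geq_minl.
  exact: leq_trans (geq_minr _ _) ler.
- have := mem_index_enum (in_tuple s).
  elim: (index_enum _) => // q r IH; rewrite inE big_cons => /predU1P[<-|/IH ler].
    by rewrite es; exact: geq_minl.
  by case: ifP => // _; exact: leq_trans (geq_minr _ _) ler.
Qed.

Lemma gamma_attained s : ear_decomposition s ->
  exists2 s', ear_decomposition s' & odd_lobes s' = gamma.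
Proof.
move=> es.
suff: gamma = 0 \/ exists2 s', ear_decomposition s' & odd_lobes s' = gamma.
  case=> // g0; exists s => //; apply/eqP.
  by rewrite eqn_leq odd_lobes_le_gamma // g0.
rewrite /gamma; elim/big_ind: _ => [|x y Kx Ky|t _]; first by left.
  by rewrite /maxn; case: ifP.
elim/big_ind: _ => [|x y Kx Ky|r er]; first by left.
  by rewrite /maxn; case: ifP.
by right; exists r.
Qed.

Lemma phi_attained s : ear_decomposition s ->
  exists2 s', ear_decomposition s' & even_lobes s' = phi.
Proof.
move=> es.
suff: phi = #|E| \/ exists2 s', ear_decomposition s' & even_lobes s' = phi.
  case=> // g0; exists s => //; apply/eqP.
  rewrite eqn_leq phi_le_even_lobes // g0 andbT.
  apply: leq_trans (size_ear_decomposition es).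
  rewrite -[leqRHS]card_ord -sum1_card; apply: leq_sum => i _; exact: leq_b1.
rewrite /phi; elim/big_ind: _ => [|x y Kx Ky|t _]; first by left.
  by rewrite /minn; case: ifP.
elim/big_ind: _ => [|x y Kx Ky|r er]; first by left.
  by rewrite /minn; case: ifP.
by right; exists r.
Qed.

End MatroidTheory.

(* Multigraphs, loops allowed. The two ends of an edge are labelled by
   booleans; the matroids below do not depend on this labelling. *)
Record graph (V E : finType) := Graph { endpoint : E -> bool -> V }.

Section GraphicMatroid.
Variables (V E : finType) (G : graph V E).
Implicit Types (F I J : {set E}) (d : E * bool) (p : seq (E * bool)).

(* The dart (e, b) is the edge e traversed from its end b to its end ~~ b. *)
Definition dtail d := endpoint G d.1 d.2.
Definition dhead d := endpoint G d.1 (~~ d.2).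

Definition graph_cycle p :=
  [&& p != [::], cycle (fun d d' => dhead d == dtail d') p,
      uniq [seq dtail d | d <- p] & uniq [seq d.1 | d <- p]].

(* A cycle has at most #|E| edges, see [forestP]. *)
Definition forest F :=
  [forall t : 'I_#|E|.+1, forall p : t.-tuple (E * bool),
    graph_cycle p ==> ~~ all (fun d => d.1 \in F) p].

Lemma forestP F :
  reflect (forall p, graph_cycle p -> ~~ all (fun d => d.1 \in F) p) (forest F).
Proof.
apply: (iffP idP) => [fF p cp|H]; last first.
  by apply/forallP => t; apply/forallP => p; apply/implyP; apply: H.
have ltp : size p < #|E|.+1.
  have /and4P[_ _ _ up] := cp; rewrite ltnS -(size_map (fun d => d.1)).
  by rewrite -(card_uniqP up) max_card.
by have /forallP/(_ (in_tuple p))/implyP := forallP fF (Ordinal ltp); apply.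
Qed.

Definition adjacent F : rel V := fun x y =>
  [exists d, [&& d.1 \in F, dtail d == x & dhead d == y]].

Lemma adjacent_csym F : connect_sym (adjacent F).
Proof.
apply: sym_connect_sym => x y; apply/existsP/existsP => -[[e b]];
  rewrite /dtail /dhead /= => /and3P[eF /eqP<- /eqP<-]; exists (e, ~~ b);
  by rewrite /dtail /dhead /= negbK eF !eqxx.
Qed.

Lemma path_darts F x q : path (adjacent F) x q -> uniq (x :: q) ->
  exists p, [/\ all (fun d => d.1 \in F) p, map dtail p = belast x q,
    uniq [seq d.1 | d <- p],
    all (fun d => (dtail d \in x :: q) && (dhead d \in x :: q)) p
  & forall d0, dhead d0 = x ->
      path (fun d d' => dhead d == dtail d') d0 p /\
      dhead (last d0 p) = last x q].
Proof.
elim: q x => [|y q IH] x; first by exists [::]; split.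
rewrite [path _ _ _]/=.
case/andP=> /existsP[d /and3P[dF /eqP tx /eqP hy]] /IH{}IH Uxq.
have /andP[xq Uq] : (x \notin y :: q) && uniq (y :: q) by [].
have [p [pF tp Up vp pp]] := IH Uq; exists (d :: p); split=> [||||d0 hd0].
- by rewrite /= dF.
- by rewrite /= tx tp.
- rewrite /= Up andbT; apply/mapP => -[[e b] ep de].
  have /andP[] := allP vp _ ep; move: xq tx de; clear.
  case: d => e' b' /= xq tx de; subst e'.
  rewrite /dtail /dhead /= in tx *.
  by case: (eqVneq b b') => [->|]; rewrite ?tx ?(negPf xq) // -addbT;
     case: b b' tx => -[] //= ->; rewrite (negPf xq).
- rewrite /= tx hy !inE !eqxx orbT /=.
  apply/allP => d' /(allP vp) /andP[h1 h2].
  by rewrite [dtail d' \in _]inE h1 [dhead d' \in _]inE h2 !orbT.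
- by have [h1 h2] := pp d hy; rewrite /= hd0 tx eqxx h1.
Qed.

Lemma forest_bridge F e : forest F -> e \in F ->
  ~~ connect (adjacent (F :\ e)) (endpoint G e true) (endpoint G e false).
Proof.
move=> /forestP fF eF; apply/negP => /connectP[q0 pq0 lq0].
case: (shortenP pq0) lq0 => q pq Uq _ lq.
have [p [pF tp Up _ pp]] := path_darts pq Uq.
pose d : E * bool := (e, false).
have [cp lp] := pp d erefl.
have pF' : all (fun d => d.1 \in F) p.
  by apply/allP => d' /(allP pF); rewrite inE => /andP[].
have /fF : graph_cycle (d :: p).
  apply/and4P; split=> //=.
  - by rewrite rcons_path cp lp -lq /dtail eqxx.
  - by move: Uq; rewrite lastI rcons_uniq tp /dtail /= lq.
  - rewrite Up andbT; apply/mapP => -[d' /(allP pF)]; rewrite !inE => /andP[h _].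
    by move/eqP; rewrite eq_sym (negPf h).
by rewrite /= eF pF'.
Qed.

Lemma dart_path_connect F d p : all (fun d => d.1 \in F) p ->
  path (fun d d' => dhead d == dtail d') d p ->
  connect (adjacent F) (dhead d) (dhead (last d p)).
Proof.
elim: p d => [|d' p IH] d /=; first by rewrite connect0.
case/andP=> dF pF /andP[/eqP-> pp].
apply: connect_trans (IH _ pF pp); apply: connect1.
by apply/existsP; exists d'; rewrite dF !eqxx.
Qed.

Lemma forest_connect F e : forest F -> ~~ forest (e |: F) ->
  connect (adjacent F) (endpoint G e true) (endpoint G e false).
Proof.
move=> /forestP fF /forallPn[t /forallPn[p]].
rewrite negb_imply negbK => /andP[cp pF].
have /allPn[d dp dF] := fF _ cp.
have de : d.1 = e.
  by have := allP pF _ dp; rewrite !inE (negPf dF) orbF => /eqP.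
have [i q rq] := rot_to dp.
have /and4P[_ Cp _ Up] := cp.
have : cycle (fun d d' => dhead d == dtail d') (d :: q) by rewrite -rq rot_cycle.
have : uniq [seq d.1 | d <- d :: q] by rewrite -rq map_rot rot_uniq.
rewrite /= rcons_path => /andP[dq _] /andP[pq /eqP lq].
have qF : all (fun d => d.1 \in F) q.
  apply/allP => d' dq'; have : d' \in p by rewrite -(mem_rot i) rq inE dq' orbT.
  move/(allP pF); rewrite !inE => /predU1P[d'e|//].
  by case/negP: dq; rewrite de -d'e; apply: map_f.
have := dart_path_connect qF pq; rewrite lq /dhead /dtail de.
by case: (d.2) => //=; rewrite adjacent_csym.
Qed.

Import GRing.Theory.
Local Open Scope ring_scope.

Definition edge_vec e : {ffun V -> rat^o} :=
  [ffun v => (v == endpoint G e true)%:R - (v == endpoint G e false)%:R].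

Definition comp_sum F x (w : {ffun V -> rat^o}) : rat^o :=
  \sum_(v | connect (adjacent F) x v) w v.

Fact comp_sum_linear F x : linear (comp_sum F x).
Proof.
move=> a u w; rewrite /comp_sum scaler_sumr -big_split.
by apply: eq_bigr => v _; rewrite !ffunE.
Qed.
HB.instance Definition _ F x :=
  GRing.isLinear.Build rat {ffun V -> rat^o} rat^o _ _ (comp_sum_linear F x).

Lemma comp_sum_edge F x e : comp_sum F x (edge_vec e) =
  (connect (adjacent F) x (endpoint G e true))%:R
  - (connect (adjacent F) x (endpoint G e false))%:R.
Proof.
have D y : \sum_(v | connect (adjacent F) x v) (v == y)%:R
         = (connect (adjacent F) x y)%:R :> rat.
  rewrite big_mkcond (bigD1 y) //= eqxx big1 ?addr0; first by case: connect.
  by move=> v /negPf->; case: connect.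
rewrite /comp_sum -!D -sumrB; apply: eq_bigr => v _; exact: ffunE.
Qed.

Lemma forestS F F' : F \subset F' -> forest F' -> forest F.
Proof.
move=> sF /forestP fF; apply/forestP => p /fF; apply: contra.
by apply: sub_all => d; apply: (subsetP sF).
Qed.

Lemma forest0 : forest set0.
Proof.
apply/forestP => -[|d p] //= _; by rewrite inE.
Qed.

Lemma adjacent_edge F e : e \in F ->
  connect (adjacent F) (endpoint G e true) (endpoint G e false).
Proof.
move=> eF; apply/connect1/existsP; exists (e, true).
by rewrite /= eF !eqxx.
Qed.

Lemma forest_free (s : seq E) : uniq s -> forest [set e in s] ->
  free [seq edge_vec e | e <- s].
Proof.
elim: s => [|e s IH] /=; first by rewrite nil_free.
case/andP=> es Us fs; rewrite free_cons IH // ?andbT; last first.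
  by apply: forestS fs; apply/subsetP => x; rewrite !inE orbC => ->.
set F := [set x in s]; set x := endpoint G e true.
have eF : [set x in e :: s] :\ e = F.
  apply/setP=> y; rewrite !inE; case: eqVneq => // ->.
  by rewrite (negPf es).
have es' : e \in [set x in e :: s] by rewrite inE mem_head.
have := forest_bridge fs es'; rewrite eF -/x => nc; apply/negP => ein.
have sub : (<<[seq edge_vec e | e <- s]>> <= lker (linfun (comp_sum F x)))%VS.
  apply/span_subvP => _ /mapP[e' e's ->]; rewrite memv_ker lfunE /=.
  have /adjacent_edge/(same_connect_r (@adjacent_csym F)) : e' \in F by rewrite inE.
  by move=> E'; rewrite comp_sum_edge E' subrr.
have := subvP sub _ ein; rewrite memv_ker lfunE /= comp_sum_edge.
by rewrite connect0 (negPf nc) subr0 oner_eq0.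
Qed.

Definition vertex_vec (x : V) : {ffun V -> rat^o} := [ffun v => (v == x)%:R].

Lemma edge_vecE e :
  edge_vec e = vertex_vec (endpoint G e true) - vertex_vec (endpoint G e false).
Proof. by apply/ffunP => v; rewrite !ffunE. Qed.

Lemma connect_span I x y : connect (adjacent I) x y ->
  vertex_vec x - vertex_vec y \in <<[seq edge_vec e | e <- enum I]>>%VS.
Proof.
case/connectP=> p; elim: p x => [|z p IH] x /=.
  by move=> _ ->; rewrite subrr mem0v.
case/andP=> /existsP[[e b] /and3P[/= eI /eqP<- /eqP hz]] /IH{}IH /IH zin.
rewrite -(subrKA (vertex_vec z)); apply: memvD => {zin}//.
have ev : edge_vec e \in <<[seq edge_vec e | e <- enum I]>>%VS.
  by apply/memv_span/map_f; rewrite mem_enum.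
rewrite -hz /dtail /dhead /=; case: b {hz} => /=; first by rewrite -edge_vecE.
by rewrite -opprB memvN -edge_vecE.
Qed.

Lemma forest_leq I J : forest J ->
  (forall e, e \in J ->
     connect (adjacent I) (endpoint G e true) (endpoint G e false)) ->
  (#|J| <= #|I|)%N.
Proof.
move=> fJ cJ; have := forest_free (enum_uniq (mem J)).
have -> : [set e in enum J] = J by apply/setP=> e; rewrite inE mem_enum.
move=> /(_ fJ) /eqP dJ; rewrite !cardE.
rewrite -[X in (X <= _)%N](size_map edge_vec) -dJ.
rewrite -[X in (_ <= X)%N](size_map edge_vec).
apply: leq_trans (dim_span _); apply/dimvS/span_subvP => _ /mapP[e eJ ->].
by rewrite edge_vecE; apply/connect_span/cJ; rewrite -mem_enum.
Qed.

Local Close Scope ring_scope.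

Fact forest_aug I J : forest I -> forest J -> #|I| < #|J| ->
  exists2 e, e \in J :\: I & forest (e |: I).
Proof.
move=> fI fJ ltIJ.
case: (pickP [pred e | (e \in J :\: I) && forest (e |: I)]) => [e|H].
  by case/andP; exists e.
suff : #|J| <= #|I| by rewrite leqNgt ltIJ.
apply: forest_leq fJ _ => e eJ; case: (boolP (e \in I)) => [|eI].
  exact: adjacent_edge.
by apply: (forest_connect fI); have := H e; rewrite /= inE eI eJ /= => ->.
Qed.

Definition graphic_matroid := Matroid forest0 forestS forest_aug.

Definition cographic_matroid := dual graphic_matroid.

End GraphicMatroid.

(* The edge (i, j) joins the i-th left vertex to the j-th right vertex. *)
Definition complete_bipartite (m n : nat) : graph ('I_m + 'I_n)%type ('I_m * 'I_n)%type :=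
  Graph (fun e b => if b then inr e.2 else inl e.1).

(* Main.v *)
Require Import Defs.
From mathcomp Require Import all_boot all_order all_algebra.
From mathcomp Require Import zify.

(** Call |D| minus the size of a largest independent subset of D the nullity
    of D. Adding to D a circuit that is not contained in D raises the nullity,
    and condition (E3) says exactly that adding an ear raises it by only one:
    the lobe is then a circuit of the contraction by D. Hence an ear
    decomposition of any matroid has |E| - r lobes ([ear_decomposition_size]).
    Conversely, circuits that cover E and satisfy (E1) and (E2) satisfy (E3)
    as soon as there are |E| - r of them ([ear_decomposition_of_size]), since
    a violation of (E3) would leave room for one more circuit.

    As the lobes partition the 16 edges of K_{4,4}, the number of odd lobes is
    even; as there are 16 - 9 = 7 lobes, it is at most 6 and at least one lobe
    is even. The stars of all vertices but one, suitably ordered, have lobes of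
    sizes 4, 3, 3, 3, 1, 1, 1. This gives gamma = 6, phi = 1 and
    eta = (9 + 1) / 2 = 5.

    For mu, every cut is a disjoint union of bonds, so that J is a join of a
    cographic matroid when at most half of every cut lies in J ([joinP]). A
    perfect matching of K_{4,4} has this property. Conversely, let J have it.
    Vertex stars show that J has maximum degree at most 2, and cuts around an
    edge show that two vertices of degree 2 on different sides are adjacent in
    J ([deg2_adjacent]). If A on the left and B on the right are such that no
    edge of J leaves A + B, then the cut around A and the complement of B
    contains J; it has 8 edges if |A| = 2 or |B| = 2, and then |J| <= 4
    ([closed_join_card]). If |J| > 4, both sides have a vertex of degree 2, and
    the absence of such a closed pair (A, B) forces a vertex of degree 3
    ([cut_condition_card]). *)

Set Implicit Arguments.
Unset Strict Implicit.
Unset Printing Implicit Defensive.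

(** * Nullity and the number of ears *)

Lemma card_setUD (T : finType) (A B : {set T}) :
  #|A :|: B| = #|A| + #|B :\: A|.
Proof. by rewrite -(cardsID A) (setIidPr (subsetUl A B)) setDUl setDv set0U. Qed.

Section Nullity.
Variables (E : finType) (M : matroid E).
Implicit Types (A B C D : {set E}) (s : seq {set E}).

Definition set_rank D := \max_(A : {set E} | indep M A && (A \subset D)) #|A|.

Definition nullity D := #|D| - set_rank D.

Lemma set_rank_max A D : indep M A -> A \subset D -> #|A| <= set_rank D.
Proof.
by move=> iA sA; apply: (bigmax_sup A) => //; rewrite iA.
Qed.

Lemma set_rank_attained D :
  exists B, [/\ indep M B, B \subset D & #|B| = set_rank D].
Proof.
have H : 0 < #|[pred A : {set E} | indep M A && (A \subset D)]|.
  by apply/card_gt0P; exists set0; rewrite inE indep0 sub0set.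
have [B /andP[iB sB] eB] := eq_bigmax_cond (fun A : {set E} => #|A|) H.
by exists B; rewrite iB sB /set_rank eB.
Qed.

Lemma set_rank_le_card D : set_rank D <= #|D|.
Proof.
by have [B [_ sB <-]] := set_rank_attained D; apply: subset_leq_card.
Qed.

Lemma nullity0 : nullity set0 = 0.
Proof. by rewrite /nullity cards0. Qed.

Lemma nullityT : nullity setT = #|E| - rank M.
Proof.
rewrite /nullity cardsT; congr (_ - _); apply: eq_bigl => A.
by rewrite subsetT andbT.
Qed.

(** Iterated augmentation: a largest independent set between A and its union with
    B cannot be augmented from B. *)
Lemma indep_grow A B : indep M A -> indep M B ->
  exists K, [/\ indep M K, A \subset K, K \subset A :|: B & #|B| <= #|K|].
Proof.
move=> iA iB; pose P X := [&& indep M X, A \subset X & X \subset A :|: B].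
have PA : P A by rewrite /P iA subxx subsetUl.
have [K mK sAK] := maxset_exists PA.
have /and3P[iK _ sK] := maxsetp mK.
exists K; split=> //; rewrite leqNgt; apply/negP => /(indep_aug iK iB)[e].
rewrite inE => /andP[eK eB] ie.
have /(maxsetsup mK) : P (e |: K).
  rewrite /P ie (subset_trans sAK (subsetUr _ _)) /= subUset sK andbT.
  by rewrite sub1set inE eB orbT.
by move/(_ (subsetUr _ _))/setP/(_ e); rewrite !inE eqxx (negPf eK).
Qed.

Lemma dependent_circuit A : ~~ indep M A -> exists2 C, circuit M C & C \subset A.
Proof.
move=> dA; have [C] := @minset_exists _ (fun A => ~~ indep M A) _ dA.
by exists C.
Qed.

Lemma circuit_proper_indep A C : circuit M C -> A \proper C -> indep M A.
Proof.
move=> /minsetP[_ mC] /properP[sA [e eC eA]]; apply: contraNT eA => dA.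
by rewrite (mC _ dA sA).
Qed.

(** Take a largest independent B in D + C and grow the intersection of C and D
    (independent, being a proper part of C) by elements of B up to at least
    the size of B. The result does not contain C, so it misses an element of
    C - D; its part in D has thus at least |B| - |C - D| + 1 elements. *)
Lemma nullity_circuit C D : circuit M C -> ~~ (C \subset D) ->
  nullity D < nullity (D :|: C).
Proof.
move=> cC nCD; have [B [iB sB eB]] := set_rank_attained (D :|: C).
have iCD : indep M (C :&: D).
  by apply: circuit_proper_indep cC _; rewrite properE subsetIl subsetI subxx.
have [K [iK sCK sK leK]] := indep_grow iCD iB.
have sKD : K \subset D :|: C.
  apply: subset_trans sK _; rewrite subUset sB andbT.
  by apply: subset_trans (subsetIl _ _) (subsetUr _ _).
have ltP : #|K :\: D| < #|C :\: D|.
  apply: proper_card; rewrite properE; apply/andP; split.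
    apply/subsetP=> x; rewrite !inE => /andP[xD] /(subsetP sKD).
    by rewrite !inE (negPf xD).
  apply/negP=> sCDK; have /negP[] := minsetp cC; apply: indepS iK.
  rewrite -(setID C D) subUset sCK; apply: subset_trans sCDK _; exact: subsetDl.
have leKD : #|K :&: D| <= set_rank D.
  by apply: set_rank_max (subsetIr _ _); apply: indepS iK; exact: subsetIl.
have cU := card_setUD D C.
have := cardsID D K; rewrite /nullity; have := set_rank_le_card D.
lia.
Qed.

(** The minimality hypothesis makes C - D a circuit of the contraction by D.
    Removing one element p of C - D and adding the rest to a largest
    independent subset of D therefore keeps it independent: a circuit created
    in this way would meet the outside of D in a smaller set than C. *)
Lemma nullity_lobe C D : circuit M C -> C :\: D != set0 ->
    (forall C', circuit M C' -> C' :&: D != set0 -> C' :\: D != set0 ->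
       ~~ (C' :\: D \proper C :\: D)) ->
  nullity (D :|: C) = (nullity D).+1.
Proof.
move=> cC /set0Pn[p pP] minC; apply/eqP; rewrite eqn_leq.
rewrite nullity_circuit ?andbT //; last first.
  by apply/subsetPn; exists p; move: pP; rewrite inE => /andP[].
have [B [iB sB eB]] := set_rank_attained D.
pose I := B :|: (C :\: D) :\ p.
have iI : indep M I.
  apply: contraT => /dependent_circuit[C' cC' sC'].
  have sP : C' :\: D \subset (C :\: D) :\ p.
    apply/subsetP=> x; rewrite inE => /andP[xD] /(subsetP sC').
    by rewrite inE => /orP[/(subsetP sB)|//]; rewrite (negPf xD).
  have pP' : (C :\: D) :\ p \proper C :\: D by rewrite properD1.
  have prP := sub_proper_trans sP pP'.
  have [C'D|nC'D] := boolP (C' \subset D).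
    have /negP[] := minsetp cC'; apply: indepS iB; apply/subsetP=> x xC'.
    have := subsetP sC' x xC'; rewrite !inE (subsetP C'D x xC') /=.
    by rewrite !andbF orbF.
  (* The hypothesis only covers circuits meeting D; a circuit that avoids D
     lies inside C, which is itself a circuit. *)
  have [C'0|C'n0] := eqVneq (C' :&: D) set0.
    have eC' : C' :\: D = C' by apply/setDidPl; rewrite -setI_eq0 C'0.
    have /negP[] := minsetp cC'; apply: circuit_proper_indep cC _.
    by rewrite -eC'; apply: proper_sub_trans prP (subsetDl _ _).
  by have /negP[] : ~~ (C' :\: D \proper C :\: D) by apply: minC; rewrite ?setD_eq0.
have sI : I \subset D :|: C.
  rewrite setUSS //; apply: subset_trans (subsetDl _ _) _; exact: subsetDl.
have cU := card_setUD D C.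
have cI : #|I| = #|B| + #|(C :\: D) :\ p|.
  rewrite card_setUD; congr (_ + #|pred_of_set _|).
  apply/setP=> x; rewrite !inE.
  by case: (boolP (x \in B)) => [/(subsetP sB)->|]; rewrite ?andbF.
have := set_rank_max iI sI; have := cardsD1 p (C :\: D); rewrite pP.
have := set_rank_le_card D.
rewrite /nullity; lia.
Qed.

Lemma span_prefix0 s : span_prefix s 0 = set0.
Proof. by rewrite /span_prefix take0 big_nil. Qed.

Lemma span_prefixS s i : i < size s ->
  span_prefix s i.+1 = span_prefix s i :|: nth set0 s i.
Proof.
by move=> lti; rewrite /span_prefix (take_nth set0 lti) -cats1 big_cat big_seq1.
Qed.

Lemma sum_card_lobe s i : i <= size s ->
  \sum_(0 <= k < i) #|lobe s k| = #|span_prefix s i|.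
Proof.
elim: i => [|i IH] lti; first by rewrite big_nil span_prefix0 cards0.
rewrite big_nat_recr //= IH 1?ltnW // span_prefixS // /lobe.
by rewrite card_setUD.
Qed.

Lemma nullity_prefix_lower s i n k : all (circuit M) s ->
    (forall j, i <= j < size s -> lobe s j != set0) ->
    i <= k -> k <= size s -> n <= nullity (span_prefix s i) ->
  n + (k - i) <= nullity (span_prefix s k).
Proof.
move=> /allP cs ls leik leks len.
elim: k leik leks => [|k IH].
  by rewrite leqn0 sub0n addn0 => /eqP i0; rewrite i0 in len.
rewrite leq_eqVlt => /predU1P[<- _|]; first by rewrite subnn addn0.
rewrite ltnS => leik ltk; rewrite subSn // addnS span_prefixS //.
apply: leq_ltn_trans (IH leik (ltnW ltk)) _; apply: nullity_circuit.
  exact/cs/mem_nth.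
by rewrite -setD_eq0 ls // leik.
Qed.

Lemma rank_le_card : rank M <= #|E|.
Proof.
by apply/bigmax_leqP => A _; apply: max_card.
Qed.

Lemma lobe_first_neq0 s : all (circuit M) s -> 0 < size s -> lobe s 0 != set0.
Proof.
move=> /allP cs s_gt0; rewrite /lobe span_prefix0 setD0; apply/eqP => s0.
by have /minsetp := cs _ (mem_nth set0 s_gt0); rewrite s0 indep0.
Qed.

Lemma lobe_neq0 s i : ear_decomposition M s -> i < size s -> lobe s i != set0.
Proof.
case/and4P=> _ cs _ /forallP es; case: i => [|i] lti; last first.
  by have /and3P[] := implyP (es (Ordinal lti)) isT.
exact: lobe_first_neq0.
Qed.

Lemma ear_decomposition_size s : ear_decomposition M s ->
  size s + rank M = #|E|.
Proof.
move=> es; have lobe0 := lobe_neq0 es.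
case/and4P: es => _ cs /eqP eT /forallP es.
suff H i : i <= size s -> nullity (span_prefix s i) = i.
  by have := H _ (leqnn _); rewrite eT nullityT; have := rank_le_card; lia.
elim: i => [|i IH] lti; first by rewrite span_prefix0 nullity0.
rewrite span_prefixS // nullity_lobe ?IH 1?ltnW //.
- exact/(allP cs)/mem_nth.
- exact: lobe0.
- move=> C cC C1 C2; case: i lti {IH} C1 C2 => [|i] lti C1 C2.
    by rewrite span_prefix0 setI0 eqxx in C1.
  have /and3P[_ _ /forallP/(_ C)/implyP] := implyP (es (Ordinal lti)) isT.
  by apply; rewrite cC C1 C2.
Qed.

(** Read (E3) off a count. Suppose that the circuit C violates (E3) at step i.
    Inserting C just before the i-th ear yields another sequence of circuits,
    each not contained in the union of the previous ones. Its length
    |E| - r + 1 exceeds the nullity of E, contradicting [nullity_circuit]. *)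
Lemma ear_decomposition_of_size s :
    0 < size s -> all (circuit M) s -> span_prefix s (size s) = setT ->
    (forall i, 0 < i < size s -> nth set0 s i :&: span_prefix s i != set0) ->
    (forall i, 0 < i < size s -> lobe s i != set0) ->
    size s + rank M = #|E| ->
  ear_decomposition M s.
Proof.
move=> s_gt0 cs eT meets lobe0 sz; apply/and4P; split=> //.
- by rewrite -size_eq0 -lt0n.
- exact/eqP.
apply/forallP=> -[i lti] /=; apply/implyP => i0; rewrite meets ?lobe0 ?i0 //=.
apply/forallP=> C; apply/implyP=> /and3P[cC _ C0]; apply/negP=> ltC.
have nC x : x \notin span_prefix s i -> x \in C -> x \in lobe s i.
  by move=> xD xC; apply: (subsetP (proper_sub ltC)); rewrite inE xD.
have lo0 j : 0 <= j < size s -> lobe s j != set0.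
  by case: j => [|j] ltj; [apply: lobe_first_neq0 | apply: lobe0].
have Ni : i <= nullity (span_prefix s i).
  by rewrite -[leqLHS]subn0; apply: (@nullity_prefix_lower s 0 0 i) => //; apply: ltnW.
(* The two increments below come from C and then from the i-th ear, which
   together add no more elements than the i-th ear alone. *)
have NC : i < nullity (span_prefix s i :|: C).
  by apply: leq_ltn_trans Ni (nullity_circuit cC _); rewrite -setD_eq0.
have NS : i.+1 < nullity (span_prefix s i.+1).
  rewrite span_prefixS //.
  have -> : span_prefix s i :|: nth set0 s i =
            span_prefix s i :|: C :|: nth set0 s i.
    apply/setP=> x; rewrite !inE.
    case: (boolP (x \in span_prefix s i)) => //= xD.
    case: (boolP (x \in C)) => //= xC.
    by have := nC x xD xC; rewrite inE => /andP[].
  apply: leq_ltn_trans NC (nullity_circuit _ _); first exact/(allP cs)/mem_nth.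
  have /properP[_ [x]] := ltC; rewrite /lobe !inE => /andP[xD xi] xC.
  apply/subsetPn; exists x => //; rewrite inE (negPf xD) /=.
  by move: xC; rewrite xD.
have L j : i < j < size s -> lobe s j != set0.
  by case/andP=> ij ltj; apply: lobe0; rewrite ltj (leq_trans _ ij).
have := nullity_prefix_lower cs L lti (leqnn _) NS.
by rewrite eT nullityT; have := rank_le_card; lia.
Qed.

Lemma odd_even_lobes s : odd_lobes s + even_lobes s = size s.
Proof.
rewrite -big_split -[RHS]card_ord -sum1_card; apply: eq_bigr => i _.
by case: odd.
Qed.

(** The lobes partition E. *)
Lemma odd_odd_lobes s : ear_decomposition M s -> odd (odd_lobes s) = odd #|E|.
Proof.
case/and4P=> _ _ /eqP eT _; rewrite -cardsT -eT -(sum_card_lobe (leqnn _)).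
rewrite big_mkord /odd_lobes.
by elim/big_rec2: _ => // i n m _ IH; rewrite !oddD IH oddb.
Qed.

End Nullity.

(** * Cuts and joins in cographic matroids *)

Section Cuts.
Variables (V E : finType) (G : graph V E).
Implicit Types (A F J : {set E}) (S T : {set V}).

Definition cut S : {set E} :=
  [set e | (endpoint G e true \in S) != (endpoint G e false \in S)].

Lemma connect_cut F S x y : [disjoint F & cut S] ->
  connect (adjacent G F) x y -> (x \in S) = (y \in S).
Proof.
move=> dF; apply: (@closed_connect _ _ (mem S)) => u v /existsP[[e b]].
rewrite /dtail /dhead /= => /and3P[eF /eqP <- /eqP <-].
have := disjointFr dF eF; rewrite inE => /negbFE/eqP.
by case: b => /=.
Qed.

(** A set is independent in the dual when its complement contains a base of
    the graphic matroid, that is, when deleting it does not increase the number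
    of connected components. For a disconnected graph, cuts separating whole
    components are empty, hence the form of the criterion. *)
Lemma cographic_indepP A :
  reflect (forall S, cut S \subset A -> cut S = set0)
          (indep (cographic_matroid G) A).
Proof.
apply: (iffP existsP) => [[B /andP[/maxsetP[fB mB] dAB]] S sSA|H].
  apply/setP=> e; rewrite in_set0; apply/negP => eS.
  have dB : [disjoint B & cut S] by rewrite disjoint_sym (disjointWl sSA).
  have eB : e \notin B by rewrite (disjointFr dAB) // (subsetP sSA).
  have nf : ~~ forest G (e |: B).
    apply/negP=> fe; have /setP/(_ e) := mB _ fe (subsetUr _ _).
    by rewrite !inE eqxx (negPf eB).
  by have := connect_cut dB (forest_connect fB nf); move: eS; rewrite inE => /eqP.
(* A maximal forest F in the complement of A spans every edge: the set S of
   vertices that an end of e reaches without A has a cut contained in A. *)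
have [F mF _] := @maxset_exists _ (fun F => forest G F && (F \subset ~: A)) set0
   (introT andP (conj (forest0 G) (sub0set _))).
have /andP[fF sF] := maxsetp mF.
have cF e : e \in ~: A ->
    connect (adjacent G F) (endpoint G e true) (endpoint G e false).
  move=> eA; case: (boolP (e \in F)) => [|eF]; first exact: adjacent_edge.
  apply: forest_connect => //; apply/negP => fe.
  have /(maxsetsup mF) : forest G (e |: F) && (e |: F \subset ~: A).
    by rewrite fe subUset sub1set eA.
  by move/(_ (subsetUr _ _))/setP/(_ e); rewrite !inE eqxx (negPf eF).
have cG e : connect (adjacent G F) (endpoint G e true) (endpoint G e false).
  set x := endpoint G e true; pose S := [set v | connect (adjacent G F) x v].
  have : cut S \subset A.
    apply/subsetP => d; apply: contraTT => dA; rewrite inE negbK !inE.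
    have := cF d; rewrite inE => /(_ dA).
    by move/(same_connect_r (@adjacent_csym _ _ G F))=> ->.
  move/H/setP/(_ e); rewrite !inE connect0.
  by case: connect.
exists F; apply/andP; split; last first.
  by rewrite disjoint_sym disjoints_subset.
apply/maxsetP; split=> // X fX sX; apply/esym/eqP; rewrite eqEcard sX /=.
exact: forest_leq fX (fun e _ => cG e).
Qed.

Lemma cographic_dependentP A :
  reflect (exists2 S, cut S \subset A & cut S != set0)
          (~~ indep (cographic_matroid G) A).
Proof.
apply: (iffP idP) => [dA|[S sSA S0]]; last first.
  by apply: contraNN S0 => /cographic_indepP/(_ _ sSA)->.
case: (pickP [pred S | (cut S \subset A) && (cut S != set0)]) => [S|H].
  by case/andP; exists S.
case/cographic_indepP: dA => S sSA; have := H S; rewrite /= sSA /=.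
by move/negbFE/eqP.
Qed.

Lemma circuit_cut C : circuit (cographic_matroid G) C ->
  exists2 S, C = cut S & cut S != set0.
Proof.
move=> /minsetP[/cographic_dependentP[S sSC S0] mC]; exists S => //.
by apply/esym/mC => //; apply/cographic_dependentP; exists S.
Qed.

Lemma circuit_of_cut S : cut S != set0 ->
    (forall T, cut T \subset cut S -> cut T != set0 -> cut S \subset cut T) ->
  circuit (cographic_matroid G) (cut S).
Proof.
move=> S0 mS; apply/minsetP; split; first by apply/cographic_dependentP; exists S.
move=> A /cographic_dependentP[T sTA T0] sAS.
have H : cut S \subset A by apply: subset_trans (mS T (subset_trans sTA sAS) T0) sTA.
by apply/eqP; rewrite eqEsubset sAS.
Qed.

Definition symdiff S T := [set v | (v \in S) != (v \in T)].

Lemma cut_symdiff S T : cut T \subset cut S ->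
  cut (symdiff S T) = cut S :\: cut T.
Proof.
move=> /subsetP sTS; apply/setP=> e; have := sTS e; rewrite !inE.
by do 4!case: (_ \in _) => //=; move/(_ isT).
Qed.

(** The bound for bonds extends to all cuts: a nonempty cut contains a bond, and
    removing the bond leaves a smaller cut ([cut_symdiff]). *)
Lemma joinP J :
  reflect (forall S, 2 * #|J :&: cut S| <= #|cut S|)
          (join (cographic_matroid G) J).
Proof.
apply: (iffP forallP) => [jJ S|H C]; last first.
  by apply/implyP=> /circuit_cut[S -> _].
have [n] := ubnP #|cut S|; elim: n S => // n IH S ltS.
have [->|S0] := eqVneq (cut S) set0; first by rewrite setI0 cards0.
have : ~~ indep (cographic_matroid G) (cut S) by apply/cographic_dependentP; exists S.
case/dependent_circuit=> C cC; have [T eC T0] := circuit_cut cC => sTS.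
have := implyP (jJ C) cC; rewrite eC in sTS *.
have cS := cardsID (cut T) (cut S); rewrite (setIidPr sTS) in cS.
have cJ := cardsID (cut T) (J :&: cut S).
rewrite -setIA (setIidPr sTS) -setIDA in cJ.
have T1 : 0 < #|cut T| by rewrite card_gt0.
have := IH (symdiff S T); rewrite cut_symdiff // => IHD leC.
have : #|cut S :\: cut T| < n by lia.
by move/IHD; lia.
Qed.

End Cuts.

(** * Complete bipartite graphs *)

Section CompleteBipartite.
Variables m n : nat.
Local Notation K := (complete_bipartite m n).
Implicit Types (A : {set 'I_m}) (B : {set 'I_n}).

(** The cut around A + B in K_{m,n}, with the two sides kept apart so that the
    vertex set need not be handled as a set of a sum type. *)
Definition bcut A B : {set 'I_m * 'I_n} := [set e | (e.2 \in B) != (e.1 \in A)].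

Lemma cutE (S : {set 'I_m + 'I_n}) :
  cut K S = bcut [set i | inl i \in S] [set j | inr j \in S].
Proof. by apply/setP=> e; rewrite !inE. Qed.

Lemma bcutE A B :
  bcut A B = cut K [set v | match v with inl i => i \in A | inr j => j \in B end].
Proof. by apply/setP=> e; rewrite !inE. Qed.

Lemma bipartite_joinP (J : {set 'I_m * 'I_n}) :
  reflect (forall A B, 2 * #|J :&: bcut A B| <= #|bcut A B|)
          (join (cographic_matroid K) J).
Proof.
apply: (iffP (joinP _ _)) => [H A B|H S]; first by rewrite bcutE.
by rewrite cutE.
Qed.

Lemma card_bcut A B : #|bcut A B| = #|A| * (n - #|B|) + (m - #|A|) * #|B|.
Proof.
have -> : bcut A B = setX A (~: B) :|: setX (~: A) B.
  by apply/setP=> -[i j]; rewrite !inE /=; do 2!case: (_ \in _).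
rewrite card_setUD (_ : setX (~: A) B :\: _ = setX (~: A) B); last first.
  by apply/setP=> -[i j]; rewrite !inE /=; do 2!case: (_ \in _).
have cC k (X : {set 'I_k}) : #|~: X| = k - #|X|.
  by have := cardsC X; rewrite card_ord; lia.
by rewrite !cardsX !cC.
Qed.

Definition lstar i : {set 'I_m * 'I_n} := [set e | e.1 == i].
Definition rstar j : {set 'I_m * 'I_n} := [set e | e.2 == j].

Lemma ord_other k (i : 'I_k) : 1 < k -> exists j : 'I_k, j != i.
Proof.
move=> k1; have [i0|i0] := eqVneq (i : nat) 0.
  by exists (Ordinal k1); rewrite -val_eqE /= i0.
by exists (Ordinal (ltnW k1)); rewrite -val_eqE /= eq_sym.
Qed.

(** A nonempty cut inside the star of i does not separate the other vertices,
    as these induce a connected graph: every right vertex lies on the same side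
    as any chosen left vertex i1 other than i. *)
Lemma lstar_circuit i : 1 < m -> 0 < n -> circuit (cographic_matroid K) (lstar i).
Proof.
move=> m1 n0; have E : lstar i = bcut [set i] set0.
  by apply/setP=> e; rewrite !inE; case: eqP.
rewrite E bcutE; apply: circuit_of_cut; rewrite -bcutE -E.
  by apply/set0Pn; exists (i, Ordinal n0); rewrite inE /=.
move=> T; rewrite cutE; move: [set x | _] [set x | _] => B A.
move=> /subsetP sT /set0Pn[[i' j0] ij].
have /eqP /= i'i : (i', j0).1 == i by have := sT _ ij; rewrite inE.
subst i'; have [i1 i1i] := ord_other i m1.
have same j : (j \in B) = (i1 \in A).
  by apply/eqP/negPn; have := contraNN (sT (i1, j)); rewrite !in_set /=; apply.
by apply/subsetP=> -[i' j]; rewrite !in_set /= same -(same j0) => /eqP->; move: ij;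
  rewrite in_set.
Qed.

Lemma rstar_circuit j : 0 < m -> 1 < n -> circuit (cographic_matroid K) (rstar j).
Proof.
move=> m0 n1; have E : rstar j = bcut set0 [set j].
  by apply/setP=> e; rewrite !inE; case: eqP.
rewrite E bcutE; apply: circuit_of_cut; rewrite -bcutE -E.
  by apply/set0Pn; exists (Ordinal m0, j); rewrite inE /=.
move=> T; rewrite cutE; move: [set x | _] [set x | _] => B A.
move=> /subsetP sT /set0Pn[[i0 j'] ij].
have /eqP /= j'j : (i0, j').2 == j by have := sT _ ij; rewrite inE.
subst j'; have [j1 j1j] := ord_other j n1.
have same i : (i \in A) = (j1 \in B).
  apply/esym/eqP/negPn.
  by have := contraNN (sT (i, j1)); rewrite !in_set /=; apply.
by apply/subsetP=> -[i j']; rewrite !in_set /= same -(same i0) => /eqP->; move: ij;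
  rewrite in_set.
Qed.

End CompleteBipartite.

(** The edges avoiding both vertices of index 0 are independent in the dual:
    the remaining edges form a double star, which is connected and spanning. *)
Lemma rank_cographic_bipartite m n :
  m * n <= rank (cographic_matroid (complete_bipartite m.+1 n.+1)).
Proof.
have -> : m * n = #|setX [set~ (ord0 : 'I_m.+1)] [set~ (ord0 : 'I_n.+1)]|.
  by rewrite cardsX !cardsC1 !card_ord.
rewrite /rank.
apply: (bigmax_sup (setX [set~ (ord0 : 'I_m.+1)] [set~ (ord0 : 'I_n.+1)])) => //.
apply/cographic_indepP => S; rewrite cutE.
move: [set x | _] [set x | _] => B A /subsetP sS.
have row i : (ord0 \in B) = (i \in A).
  apply/eqP/negPn.
  by have := contraNN (sS (i, ord0)); rewrite !inE /= andbF; apply.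
have col j : (j \in B) = (ord0 \in A).
  by apply/eqP/negPn; have := contraNN (sS (ord0, j)); rewrite !inE /=; apply.
by apply/setP=> -[i j]; rewrite !in_set /= col -(row ord0) (row i) eqxx.
Qed.

(** * Joins of the cographic matroid of K_{4,4} *)

Lemma pair_injl (S T : Type) (x : S) : injective (fun y : T => (x, y)).
Proof. by move=> y y' []. Qed.

Lemma pair_injr (S T : Type) (y : T) : injective (fun x : S => (x, y)).
Proof. by move=> x x' []. Qed.

Section JoinBound.
Variable J : {set 'I_4 * 'I_4}.
Hypothesis cutJ : forall A B, 2 * #|J :&: bcut A B| <= #|bcut A B|.

Definition rnbr i := [set j | (i, j) \in J].
Definition lnbr j := [set i | (i, j) \in J].

Lemma card_rnbr i : #|rnbr i| <= 2.
Proof.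
have := cutJ [set i] set0; rewrite card_bcut cards1 cards0.
suff : #|rnbr i| <= #|J :&: bcut [set i] set0| by lia.
rewrite -(card_imset (rnbr i) (@pair_injl _ _ i)).
apply/subset_leq_card/subsetP=> _ /imsetP[j jJ ->]; rewrite !inE in jJ *.
by rewrite jJ eqxx.
Qed.

Lemma card_lnbr j : #|lnbr j| <= 2.
Proof.
have := cutJ set0 [set j]; rewrite card_bcut cards1 cards0.
suff : #|lnbr j| <= #|J :&: bcut set0 [set j]| by lia.
rewrite -(card_imset (lnbr j) (@pair_injr _ _ j)).
apply/subset_leq_card/subsetP=> _ /imsetP[i iJ ->]; rewrite !inE in iJ *.
by rewrite iJ eqxx.
Qed.

(** If u and v are not adjacent in J, the cut around u + v contains all four
    edges of J at u or v, but has only 6 edges in K_{4,4}. *)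
Lemma deg2_adjacent u v : 1 < #|rnbr u| -> 1 < #|lnbr v| -> (u, v) \in J.
Proof.
move=> du dv; apply: contraT => uv.
have := cutJ [set u] [set v]; rewrite card_bcut !cards1.
suff : #|rnbr u| + #|lnbr v| <= #|J :&: bcut [set u] [set v]| by lia.
rewrite -(card_imset (rnbr u) (@pair_injl _ _ u)).
rewrite -(card_imset (lnbr v) (@pair_injr _ _ v)).
rewrite -cardsUI (_ : _ :&: _ = set0) ?cards0 ?addn0.
  apply/subset_leq_card/subsetP=> _ /setUP[] /imsetP[x xJ ->];
    rewrite !inE /= in xJ *; rewrite xJ eqxx.
  - by rewrite eqb_id; apply: contraNneq uv => <-.
  - by rewrite eq_sym eqb_id; apply: contraNneq uv => <-.
apply/setP=> -[i j]; rewrite in_set0; apply/negP=> /setIP[/imsetP[j' _ [-> _]]].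
by move=> /imsetP[i' + [ui _]]; rewrite inE -ui (negPf uv).
Qed.

(** J is contained in the cut around A and the complement of B, which has
    |A| |B| + (4 - |A|) (4 - |B|) edges; this is 8 when |A| or |B| is 2. *)
Lemma closed_join_card (A B : {set 'I_4}) :
    (forall i j, (i, j) \in J -> (i \in A) = (j \in B)) ->
  (#|A| == 2) || (#|B| == 2) -> #|J| <= 4.
Proof.
move=> clJ AB2; have := cutJ A (~: B); rewrite card_bcut (setIidPl _); last first.
  apply/subsetP=> -[i j] ij; rewrite !inE /= (clJ i j ij).
  by case: (j \in B).
have cB := cardsC B; rewrite card_ord in cB.
case/orP: AB2 => /eqP e2; first by rewrite e2; lia.
have -> : #|~: B| = 2 by lia.
by have := max_card A; rewrite card_ord; lia.
Qed.

Lemma card_rnbr_sum : #|J| = \sum_i #|rnbr i|.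
Proof.
rewrite -sum1_card (partition_big fst xpredT) //=; apply: eq_bigr => i _.
rewrite -sum1_card (reindex_onto (pair i) snd) => [|[i' j] /andP[_ /eqP<-]//].
by apply: eq_bigl => j; rewrite inE /= !eqxx !andbT.
Qed.

Lemma card_lnbr_sum : #|J| = \sum_j #|lnbr j|.
Proof.
rewrite -sum1_card (partition_big snd xpredT) //=; apply: eq_bigr => j _.
rewrite -sum1_card (reindex_onto (fun i => (i, j)) fst) => [|[i j'] /andP[_ /eqP<-]//].
by apply: eq_bigl => i; rewrite inE /= !eqxx !andbT.
Qed.

Lemma exists_gt1 (f : 'I_4 -> nat) : 4 < \sum_i f i -> exists i, 1 < f i.
Proof.
move=> lt4; apply/existsP; apply: contraLR lt4 => /existsPn le1.
rewrite -leqNgt -[leqRHS](card_ord 4) -sum1_card.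
by apply: leq_sum => i _; rewrite leqNgt.
Qed.

(** Let u and v have degree 2. As the two neighbours of v, together with
    their own neighbours, do not form a closed pair, some vertex j other than v
    is shared by a neighbour of v and a vertex not adjacent to v; it has
    degree 2, so it is adjacent to u. Symmetrically, some vertex i is
    adjacent both to a neighbour of u and to a vertex j' not adjacent to u; it
    has degree 2, so it is adjacent to v. Being of degree 2, i and j are adjacent
    as well, so that i has the three distinct neighbours v, j and j'. *)
Lemma cut_condition_card : #|J| <= 4.
Proof.
rewrite leqNgt; apply/negP => lt4.
have [u du] : exists u, 1 < #|rnbr u| by apply: exists_gt1; rewrite -card_rnbr_sum.
have [v dv] : exists v, 1 < #|lnbr v| by apply: exists_gt1; rewrite -card_lnbr_sum.
have uv := deg2_adjacent du dv.
have notcl (A B : {set 'I_4}) : (#|A| == 2) || (#|B| == 2) ->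
    exists e, (e \in J) && ((e.1 \in A) != (e.2 \in B)).
  move=> AB2; apply/existsP; apply: contraLR lt4 => /existsPn H.
  rewrite -leqNgt; apply: closed_join_card AB2 => i j ij.
  by have := H (i, j); rewrite ij => /negPn/eqP.
have [j [uj jv dj]] : exists j, [/\ (u, j) \in J, j != v & 1 < #|lnbr j|].
  pose B := [set j | [exists i in lnbr v, (i, j) \in J]].
  have [|[i j] /= /andP[ij]] := notcl (lnbr v) B.
    by rewrite [#|lnbr v| == 2]eqn_leq card_lnbr dv.
  case: (boolP (i \in lnbr v)) => iv.
    by rewrite inE => /negP[]; rewrite eq_sym eqb_id; apply/existsP; exists i; rewrite iv.
  rewrite inE eq_sym eqbF_neg negbK => /existsP[i0 /andP[i0v i0j]].
  have dj : 1 < #|lnbr j|.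
    apply/card_gt1P; exists i, i0; rewrite !inE; split=> //.
    by apply: contraNneq iv => ->.
  exists j; split=> //; first exact: deg2_adjacent.
  by apply: contraNneq iv => <-; rewrite inE.
have [i [j' [iv uj' ij' di]]] :
    exists i j', [/\ (i, v) \in J, (u, j') \notin J, (i, j') \in J & 1 < #|rnbr i|].
  pose A := [set i | [exists j in rnbr u, (i, j) \in J]].
  have [|[i j'] /= /andP[ij']] := notcl A (rnbr u).
    by rewrite [#|rnbr u| == 2]eqn_leq card_rnbr du orbT.
  case: (boolP (j' \in rnbr u)) => uj'.
    by rewrite inE eqb_id => /negP[]; apply/existsP; exists j'; rewrite uj'.
  rewrite inE eqbF_neg negbK => /existsP[j0 /andP[uj0 ij0]].
  have di : 1 < #|rnbr i|.
    apply/card_gt1P; exists j', j0; rewrite !inE; split=> //.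
    by apply: contraNneq uj' => ->.
  exists i, j'; split=> //; first exact: deg2_adjacent.
  by rewrite inE in uj'.
have := card_rnbr i; rewrite leqNgt => /negP[]; apply/card_gt2P.
exists v, j, j'; rewrite !inE iv ij' deg2_adjacent // eq_sym; split=> //; split=> //.
- by apply: contraNneq uj' => <-.
- by apply: contraNneq uj' => ->.
Qed.

End JoinBound.

(** With A and B seen as sets of indices, the matching edges in the cut are the
    elements of their symmetric difference, of size at most
    min(|A| + |B|, 8 - |A| - |B|), whereas the cut has
    4 (|A| + |B|) - 2 |A| |B| edges. *)
Lemma matching_join :
  join (cographic_matroid (complete_bipartite 4 4)) [set e | e.1 == e.2].
Proof.
apply/bipartite_joinP => A B; rewrite card_bcut.
have : #|[set e | e.1 == e.2] :&: bcut A B| <= #|(A :\: B) :|: (B :\: A)|.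
  apply: leq_trans (leq_imset_card (fun i => (i, i)) _).
  apply/subset_leq_card/subsetP => -[i j]; rewrite !inE /= => /andP[/eqP<- ij].
  by apply: imset_f; rewrite !inE; move: ij; do 2!case: (_ \in _).
have := cardsU (A :\: B) (B :\: A).
have : #|A :\: B :|: (B :\: A)| <= #|~: A| + #|~: B|.
  apply: leq_trans (leq_card_setU _ _); apply/subset_leq_card.
  by apply/subsetP=> x; rewrite !inE; do 2!case: (_ \in _).
have := cardsC A; have := cardsC B; rewrite card_ord.
have : #|A :\: B| <= #|A| by apply/subset_leq_card/subsetDl.
have : #|B :\: A| <= #|B| by apply/subset_leq_card/subsetDl.
move: #|A :\: B :|: (B :\: A)| #|_ :&: bcut _ _| #|~: A| #|~: B| => k c a' b'.
have := max_card A; have := max_card B; rewrite !card_ord.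
move: #|A| #|B| #|A :\: B| #|B :\: A| #|_ :&: _|.
move=> p q x y z; case: p => [|[|[|[|[|p]]]]] //; case: q => [|[|[|[|[|q]]]]] //; lia.
Qed.

Lemma mu_K44 : mu (cographic_matroid (complete_bipartite 4 4)) = 4.
Proof.
apply/eqP; rewrite eqn_leq; apply/andP; split.
  by apply/bigmax_leqP => J /bipartite_joinP; apply: cut_condition_card.
apply: (bigmax_sup [set e | e.1 == e.2]); first exact: matching_join.
rewrite -[leqLHS](card_ord 4).
have diag_inj : injective (fun i : 'I_4 => (i, i)) by move=> i i' [].
rewrite -(card_imset 'I_4 diag_inj).
by apply/subset_leq_card/subsetP => _ /imsetP[i _ ->]; rewrite inE.
Qed.

(** * Ear decompositions of the cographic matroid of K_{4,4} *)

Local Notation K44 := (complete_bipartite 4 4).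
Local Notation M44 := (cographic_matroid K44).
Local Notation "''o' k" := (@Ordinal 4 k isT) (at level 0, k at level 0).

(** After the star of one left vertex has been deleted, the order is chosen
    so that every later star has an odd number of new edges: 3 for each of three
    right stars, then a single edge, at the fourth right vertex, for each of the
    other left stars. *)
Definition star_ears : seq {set 'I_4 * 'I_4} :=
  [:: lstar 4 'o0; rstar 4 'o0; rstar 4 'o1; rstar 4 'o2;
      lstar 4 'o1; lstar 4 'o2; lstar 4 'o3].

Lemma span_prefixE (T : finType) (s : seq {set T}) i x :
  (x \in span_prefix s i) = has (fun C : {set T} => x \in C) (take i s).
Proof.
rewrite /span_prefix; elim: (take i s) => [|C r IH]; first by rewrite big_nil inE.
by rewrite big_cons inE IH.
Qed.

Lemma star_ears_circuits : all (circuit M44) star_ears.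
Proof. by rewrite /= !lstar_circuit ?rstar_circuit. Qed.

Lemma star_ears_cover : span_prefix star_ears (size star_ears) = setT.
Proof.
apply/setP=> -[i j]; rewrite span_prefixE /= !inE -!val_eqE /=.
by case: i => [[|[|[|[|]]]]] //=; rewrite ?orbT.
Qed.

Lemma star_ears_meet i : 0 < i < 7 ->
  nth set0 star_ears i :&: span_prefix star_ears i != set0.
Proof.
case: i => [|[|[|[|[|[|[|]]]]]]] // _; apply/set0Pn.
- by exists ('o0, 'o0); rewrite inE span_prefixE /= !inE.
- by exists ('o0, 'o1); rewrite inE span_prefixE /= !inE.
- by exists ('o0, 'o2); rewrite inE span_prefixE /= !inE.
- by exists ('o1, 'o0); rewrite inE span_prefixE /= !inE.
- by exists ('o2, 'o0); rewrite inE span_prefixE /= !inE.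
- by exists ('o3, 'o0); rewrite inE span_prefixE /= !inE.
Qed.

Lemma odd_star_lobe i : 0 < i < 7 -> odd #|lobe star_ears i|.
Proof.
case: i => [|[|[|[|[|[|[|]]]]]]] // _.
- have -> : lobe star_ears 1 = setX [set~ 'o0] [set 'o0].
    by apply/setP=> e; rewrite 3!inE span_prefixE /= !inE orbF.
  by rewrite cardsX cardsC1 cards1 card_ord.
- have -> : lobe star_ears 2 = setX [set~ 'o0] [set 'o1].
    apply/setP=> -[i j]; rewrite 3!inE span_prefixE /= !inE.
    by case: (eqVneq j 'o1) => [->|]; rewrite ?andbF ?orbF //= andbT.
  by rewrite cardsX cardsC1 cards1 card_ord.
- have -> : lobe star_ears 3 = setX [set~ 'o0] [set 'o2].
    apply/setP=> -[i j]; rewrite 3!inE span_prefixE /= !inE.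
    by case: (eqVneq j 'o2) => [->|]; rewrite ?andbF ?orbF //= andbT.
  by rewrite cardsX cardsC1 cards1 card_ord.
- have -> : lobe star_ears 4 = [set ('o1, 'o3)].
    apply/setP=> -[i j]; rewrite 3!inE span_prefixE /= !inE xpair_eqE.
    case: (eqVneq i 'o1) => [->|]; rewrite ?andbF //=.
    by case: j => [[|[|[|[|]]]]].
  by rewrite cards1.
- have -> : lobe star_ears 5 = [set ('o2, 'o3)].
    apply/setP=> -[i j]; rewrite 3!inE span_prefixE /= !inE xpair_eqE.
    case: (eqVneq i 'o2) => [->|]; rewrite ?andbF //=.
    by case: j => [[|[|[|[|]]]]].
  by rewrite cards1.
- have -> : lobe star_ears 6 = [set ('o3, 'o3)].
    apply/setP=> -[i j]; rewrite 3!inE span_prefixE /= !inE xpair_eqE.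
    case: (eqVneq i 'o3) => [->|]; rewrite ?andbF //=.
    by case: j => [[|[|[|[|]]]]].
  by rewrite cards1.
Qed.

Lemma star_ears_lobe i : 0 < i < 7 -> lobe star_ears i != set0.
Proof.
by move=> /odd_star_lobe; apply: contraTneq => ->; rewrite cards0.
Qed.

(** The seven stars give nullity at least 7, hence rank at most 9; the
    complement of a double star gives rank at least 9. *)
Lemma rank_K44 : rank M44 = 9.
Proof.
have := @nullity_prefix_lower _ M44 star_ears 0 0 7 star_ears_circuits.
rewrite star_ears_cover nullityT card_prod card_ord => H.
have := @rank_cographic_bipartite 3 3.
suff : 7 <= 16 - rank M44 by lia.
apply: H => // i /andP[_]; case: i => [_|i lti]; last exact: star_ears_lobe.
exact: lobe_first_neq0 star_ears_circuits _.
Qed.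

Lemma star_ears_decomposition : ear_decomposition M44 star_ears.
Proof.
apply: ear_decomposition_of_size => //.
- exact: star_ears_circuits.
- exact: star_ears_cover.
- exact: star_ears_meet.
- exact: star_ears_lobe.
- by rewrite rank_K44 card_prod card_ord.
Qed.

Lemma odd_lobes_star_ears : 6 <= odd_lobes star_ears.
Proof.
rewrite /odd_lobes big_ord_recl.
apply: leq_trans (leq_addl _ _).
rewrite (eq_bigr (fun=> 1)) => [|i _]; last by rewrite odd_star_lobe // (ltn_ord (lift ord0 i)).
by rewrite sum_nat_const card_ord.
Qed.

(** Seven odd lobes would have an odd total size, which is not 16. *)
Lemma odd_lobes_K44 s : ear_decomposition M44 s ->
  odd_lobes s <= 6 /\ odd_lobes s + even_lobes s = 7.
Proof.
move=> es; have := ear_decomposition_size es; have := odd_odd_lobes es.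
have := odd_even_lobes s; rewrite rank_K44 card_prod card_ord.
by case: (ltngtP (odd_lobes s) 7) => [||->]; lia.
Qed.

Lemma gamma_K44 : gamma M44 = 6.
Proof.
have := odd_lobes_le_gamma star_ears_decomposition.
have [s es <-] := gamma_attained star_ears_decomposition.
have [le6 _] := odd_lobes_K44 es => leg; have := odd_lobes_star_ears; lia.
Qed.

Lemma phi_K44 : phi M44 = 1.
Proof.
have := phi_le_even_lobes star_ears_decomposition.
have [s es <-] := phi_attained star_ears_decomposition.
have := odd_lobes_K44 es; have := odd_lobes_K44 star_ears_decomposition.
by have := odd_lobes_star_ears; lia.
Qed.

Theorem proposition3p1 :
  let M := cographic_matroid (complete_bipartite 4 4) in
  [/\ mu M = 4%N, gamma M = 6%N, eta M = (5%:R : rat)%R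
    & ((mu M)%:R < eta M :> rat)%R].
Proof.
have eta5 : eta M44 = (5%:R : rat)%R by rewrite /eta rank_K44 phi_K44.
split; rewrite ?mu_K44 ?gamma_K44 ?eta5 //.
Qed.
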